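(* Let $L$ be an infinitely distributive lattice. The collection $\mathfrak I_L$ of all $O$-closed ideals of $L$ forms a complete lattice when ordered by set inclusion. For any family $\{A_i: i\in I\}$ in $\mathfrak I_L$, $$\bigvee_{i}{}^{\mathfrak I_L}A_i=\Bigl(\bigcup_i A_i\Bigr)^{\sigma_L}\quad\text{and}\quad \bigwedge_{i}{}^{\mathfrak I_L}A_i=\bigcap_i A_i .$$ In addition, $\mathfrak I_L$ satisfies the Join-Infinite Distributive Law.
   Context: A lattice $L$ satisfies the Join-Infinite Distributive Law (JID) if whenever $\bigvee A$ exists, $x\wedge\bigvee A=\bigvee_{a\in A}(x\wedge a)$ for every $x\in L$; it satisfies the Meet-Infinite Distributive Law (MID) if whenever $\bigwedge A$ exists, $x\vee\bigwedge A=\bigwedge_{a\in A}(x\vee a)$ for every $x\in L$. $L$ is infinitely distributive if it satisfies both. A net $(x_\gamma)$ in $L$ order converges to $x\in L$ if there are a directed set $M\subseteq L$ and a filtered (downward directed) set $N\subseteq L$ with $\bigvee M=x=\bigwedge N$ such that for every $(m,n)\in M\times N$ the net is eventually in $[m,n]=\{z: m\le z\le n\}$. For $A\subseteq L$, $A^O_1$ denotes the set of all $x\in L$ that are order limits of nets in $A$; $A$ is $O$-closed if $A=A^O_1$. An (order) ideal of $L$ is a downset closed under finite joins. For $A\subseteq L$, $A^{\sigma_L}$ is the smallest $O$-closed ideal of $L$ containing $A$. A lattice is complete if every subset, including the empty set, has both a supremum and an infimum. *)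

(* Defs.v *)
From HB Require Import structures.
From mathcomp Require Import all_boot all_order.
From mathcomp Require Import boolp classical_sets functions cardinality.

Set Implicit Arguments.
Unset Strict Implicit.
Unset Printing Implicit Defensive.

Import Order.TTheory.

Local Open Scope classical_set_scope.

Section InfiniteDistributivity.
Context {d : Order.disp_t}.

(* [supremums A s] reads: the supremum of A exists and is equal to s. *)
Definition JID (L : latticeType d) : Prop :=
  forall (A : set L) (s : L), supremums A s ->
  forall x : L, supremums [set (x `&` a)%O | a in A] (x `&` s)%O.

Definition MID (L : latticeType d) : Prop :=
  forall (A : set L) (s : L), infimums A s ->
  forall x : L, infimums [set (x `|` a)%O | a in A] (x `|` s)%O.

Definition infinitely_distributive (L : latticeType d) : Prop :=
  JID L /\ MID L.

Definition complete_lattice (L : latticeType d) : Prop :=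
  forall A : set L, supremums A !=set0 /\ infimums A !=set0.

End InfiniteDistributivity.

(* Directed sets are nonempty by convention. *)
Definition directed_by {T : Type} (R : T -> T -> Prop) (D : set T) : Prop :=
  D !=set0 /\
  forall a b, D a -> D b -> exists c, [/\ D c, R a c & R b c].

Record directed_index := DirectedIndex {
  index_sort :> Type;
  index_le : index_sort -> index_sort -> Prop;
  index_le_refl : forall i, index_le i i;
  index_le_trans : forall i j k, index_le i j -> index_le j k -> index_le i k;
  index_directed : directed_by index_le setT
}.

Section OrderConvergence.
Context {d : Order.disp_t} {L : latticeType d}.

Definition order_converges (G : directed_index) (u : G -> L) (x : L) : Prop :=
  exists M N : set L,
    [/\ directed_by (fun a b : L => (a <= b)%O) M,
        directed_by (fun a b : L => (b <= a)%O) N,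
        supremums M x, infimums N x &
        forall m n, M m -> N n ->
          exists g0 : G, forall g : G, index_le g0 g -> (m <= u g <= n)%O].

Definition order_limits (A : set L) : set L :=
  [set x | exists (G : directed_index) (u : G -> L),
             (forall g, A (u g)) /\ order_converges u x].

Definition O_closed (A : set L) : Prop := A = order_limits A.

(* Finite joins include the empty one when it exists: an ideal contains the
   bottom element of L if there is one, and set0 is an ideal exactly when L
   has no bottom element. *)
Definition is_ideal (A : set L) : Prop :=
  (forall x y : L, (x <= y)%O -> A y -> A x) /\
  (forall (F : set L) (s : L),
     finite_set F -> F `<=` A -> supremums F s -> A s).

Definition O_closed_ideal (A : set L) : Prop := is_ideal A /\ O_closed A.

Definition sigma_ideal (A : set L) : set L := smallest O_closed_ideal A.

Lemma sub_order_limits (A : set L) : A `<=` order_limits A.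
Proof.
move=> x Ax.
have unit_directed : directed_by (fun _ _ : unit => True) setT.
  by split; [exists tt | move=> a b _ _; exists tt].
pose G := @DirectedIndex unit (fun _ _ => True)
  (fun=> I) (fun _ _ _ _ _ => I) unit_directed.
exists G, (fun=> x); split=> //.
exists [set x], [set x]; split.
- by split; [exists x | move=> a b -> ->; exists x].
- by split; [exists x | move=> a b -> ->; exists x].
- by rewrite supremums1.
- by rewrite infimums1.
- by move=> m n -> ->; exists tt => g _; rewrite lexx.
Qed.

Lemma order_limits_mono (A B : set L) :
  A `<=` B -> order_limits A `<=` order_limits B.
Proof. by move=> AB x [G [u [uA ux]]]; exists G, u; split=> // g; apply: AB. Qed.

Lemma O_closed_ideal_bigcap (I : Type) (P : set I) (A : I -> set L) :
  (forall i, P i -> O_closed_ideal (A i)) ->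
  O_closed_ideal (\bigcap_(i in P) A i).
Proof.
move=> idA; split; first split.
- by move=> x y xy Ay i Pi; have [[down _] _] := idA i Pi; apply: down xy (Ay i Pi).
- move=> F s finF FA Fs i Pi; have [[_ joins] _] := idA i Pi.
  by apply: joins finF _ Fs => x Fx; apply: FA.
- apply/seteqP; split; first exact: sub_order_limits.
  move=> x Ax i Pi; have [_ ->] := idA i Pi.
  by apply: order_limits_mono x Ax => y; apply.
Qed.

Lemma O_closed_ideal_sigma (A : set L) : O_closed_ideal (sigma_ideal A).
Proof. by apply: O_closed_ideal_bigcap => B []. Qed.

End OrderConvergence.

Section OIdealLattice.
Context {d : Order.disp_t} (L : latticeType d).

Record oideal := OIdeal {
  oideal_set :> set L;
  oideal_prop : `[< O_closed_ideal oideal_set >]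
}.

HB.instance Definition _ := [isSub for oideal_set].
HB.instance Definition _ := [Choice of oideal by <:].
HB.instance Definition _ :=
  [SubChoice_isSubPOrder of oideal by <: with set_display].

Lemma oidealP (A : oideal) : O_closed_ideal A.
Proof. exact/asboolP/oideal_prop. Qed.

Lemma le_oidealP (A B : oideal) : reflect (A `<=` B) (A <= B)%O.
Proof. by apply: (iffP idP); [rewrite leEsub => /asboolP | rewrite leEsub => ?; apply/asboolP]. Qed.

Definition oideal_sigma (A : set L) : oideal :=
  OIdeal (asboolT (O_closed_ideal_sigma A)).

Definition oideal_bigcap (I : Type) (A : I -> oideal) : oideal :=
  OIdeal (asboolT (O_closed_ideal_bigcap (fun i (_ : setT i) => oidealP (A i)))).

Definition oideal_meet (A B : oideal) : oideal :=
  oideal_bigcap (fun b : bool => if b then A else B).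

Definition oideal_join (A B : oideal) : oideal := oideal_sigma (A `|` B).

Lemma oideal_meetP (A B C : oideal) :
  (A <= oideal_meet B C)%O = (A <= B)%O && (A <= C)%O.
Proof.
apply/idP/andP => [/le_oidealP AM | [/le_oidealP AB /le_oidealP AC]].
  split; apply/le_oidealP => x Ax; [exact: AM x Ax true I | exact: AM x Ax false I].
by apply/le_oidealP => x Ax [] _; [exact: AB | exact: AC].
Qed.

Lemma oideal_joinP (A B C : oideal) :
  (oideal_join A B <= C)%O = (A <= C)%O && (B <= C)%O.
Proof.
apply/idP/andP => [/le_oidealP JC | [/le_oidealP AC /le_oidealP BC]].
  split; apply/le_oidealP => x xA; apply: JC; apply: sub_gen_smallest.
    by left.
  by right.
apply/le_oidealP; apply: smallest_sub; first exact: oidealP.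
by move=> x [/AC | /BC].
Qed.

HB.instance Definition _ :=
  Order.POrder_MeetJoin_isLattice.Build _ oideal oideal_meetP oideal_joinP.

End OIdealLattice.

(* Main.v *)
Require Import Defs.
From HB Require Import structures.
From mathcomp Require Import all_boot all_order.
From mathcomp Require Import boolp classical_sets functions cardinality.
Set Implicit Arguments.
Unset Strict Implicit.
Unset Printing Implicit Defensive.
Import Order.TTheory.
Local Open Scope classical_set_scope.

(** Completeness is the usual fact about a closure system: an arbitrary
    intersection of O-closed ideals is an O-closed ideal, hence is the infimum,
    and the O-closed ideal generated by a union is the supremum.

    The distributive law holds because the lattice of O-closed ideals is a
    Heyting algebra: meeting with a fixed B is a left adjoint, so it preserves
    all existing suprema (lemma [residuated_JID]).  The right adjoint sends C
    to [residual B C], the set of the y such that b /\ y is in C for all b in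
    B.  The point is that this set is again an O-closed ideal.  It is the
    intersection, over b in B, of the preimages of C under y |-> b /\ y, and
    JID in L makes these maps preserve finite joins and order limits.  This avoids any explicit
    description of the elements of a generated O-closed ideal. *)

Section Residuation.
Context {d : Order.disp_t}.

(** Left adjoints preserve suprema; here meeting with [x] is left adjoint to
    [imp x]. *)
Lemma residuated_JID (H : latticeType d) (imp : H -> H -> H) :
  (forall x y z : H, (x `&` y <= z)%O = (y <= imp x z)%O) -> JID H.
Proof.
move=> adj A s [ubs lubs] x; split.
- by move=> _ [a Aa <-]; apply: leI2 => //; apply: ubs.
- move=> z ubz; rewrite adj; apply: lubs => a Aa.
  by rewrite -adj; apply: ubz; exists a.
Qed.

End Residuation.

Section Residual.
Context {d : Order.disp_t} {L : latticeType d} (jidL : JID L).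

(** Meeting the bounding sets with [b] gives bounding sets for the new net:
    JID handles the supremum, and meets commute with nonempty infima in every
    lattice. *)
Lemma order_converges_meet (G : directed_index) (u : G -> L) (b x : L) :
  order_converges u x -> order_converges (fun g => b `&` u g)%O (b `&` x)%O.
Proof.
move=> [M [N [[M0 dirM] [N0 dirN] supM infN evMN]]].
exists [set (b `&` m)%O | m in M], [set (b `&` n)%O | n in N]; split.
- split; first exact: image_nonempty.
  move=> _ _ [m Mm <-] [m' Mm' <-]; have [k [Mk mk m'k]] := dirM m m' Mm Mm'.
  by exists (b `&` k)%O; split; [exists k | exact: leI2 | exact: leI2].
- split; first exact: image_nonempty.
  move=> _ _ [n Nn <-] [n' Nn' <-]; have [k [Nk kn kn']] := dirN n n' Nn Nn'.
  by exists (b `&` k)%O; split; [exists k | exact: leI2 | exact: leI2].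
- exact: jidL.
- have [lbN glbN] := infN; split.
    by move=> _ [n Nn <-]; apply: leI2 => //; apply: lbN.
  move=> z lbz; rewrite lexI; apply/andP; split.
    by have [n Nn] := N0; apply: le_trans (lbz _ _) (leIl b n); exists n.
  by apply: glbN => n Nn; apply: le_trans (lbz _ _) (leIr n b); exists n.
- move=> _ _ [m Mm <-] [n Nn <-]; have [g0 evg] := evMN m n Mm Nn.
  by exists g0 => g /evg /andP[mu un]; rewrite !leI2.
Qed.

Definition residual (B C : set L) : set L :=
  [set y | forall b, B b -> C (b `&` y)%O].

(** A finite join (the empty one included, by JID for the empty family) or an
    order limit taken in [residual B C] becomes, after meeting with [b] in [B],
    a finite join or an order limit taken in [C]. *)
Lemma O_closed_ideal_residual (B C : set L) :
  O_closed_ideal C -> O_closed_ideal (residual B C).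
Proof.
move=> [[downC joinC] closedC]; split; first split.
- by move=> x y xy By b /By; apply: downC; apply: leI2.
- move=> F s finF FR supF b Bb.
  apply: joinC (finite_image _ finF) _ (jidL supF b).
  by move=> _ [y /FR Ry <-]; apply: Ry.
- apply/seteqP; split; first exact: sub_order_limits.
  move=> x [G [u [Ru ux]]] b Bb; rewrite closedC.
  exists G, (fun g => b `&` u g)%O; split; last exact: order_converges_meet.
  by move=> g; apply: Ru.
Qed.

Definition oideal_residual (B C : oideal L) : oideal L :=
  OIdeal (asboolT (O_closed_ideal_residual B (oidealP C))).

(** The forward direction uses that ideals are downsets: for [b] in [B] and [a]
    in [A], the element [b `&` a] lies in both. *)
Lemma oideal_residualP (B A C : oideal L) :
  (B `&` A <= C)%O = (A <= oideal_residual B C)%O.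
Proof.
apply/idP/idP => /le_oidealP sub; apply/le_oidealP.
- have [[downA _] _] := oidealP A; have [[downB _] _] := oidealP B.
  move=> a Aa b Bb; apply: sub.
  have: (oideal_meet B A : set L) (b `&` a)%O; last by [].
  by move=> -[] _; [exact: downB (leIl b a) Bb | exact: downA (leIr a b) Aa].
- (* an element x of both B and A is b /\ y for b = y = x *)
  move=> x BAx; rewrite -(meetxx x).
  exact: sub _ (BAx false I) _ (BAx true I).
Qed.

End Residual.

Section Completeness.
Context {d : Order.disp_t} {L : latticeType d}.

Lemma supremums_oideal_sigma (I : Type) (A : I -> oideal L) :
  supremums (range A) (oideal_sigma (\bigcup_i (A i : set L))).
Proof.
split.
- move=> _ [i _ <-]; apply/le_oidealP => x Aix.
  by apply: sub_gen_smallest; exists i.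
- move=> C ubC; apply/le_oidealP; apply: smallest_sub; first exact: oidealP.
  by apply: bigcup_sub => i _; apply/le_oidealP; apply: ubC; exists i.
Qed.

Lemma infimums_oideal_bigcap (I : Type) (A : I -> oideal L) :
  infimums (range A) (oideal_bigcap A).
Proof.
split.
- by move=> _ [i _ <-]; apply/le_oidealP => x; apply.
- move=> C lbC; apply/le_oidealP => x Cx i _.
  by have /le_oidealP : (C <= A i)%O; [apply: lbC; exists i | apply].
Qed.

Lemma complete_oideal : complete_lattice (oideal L).
Proof.
move=> P.
have <- : range (fun A : {A | P A} => sval A) = P.
  apply/seteqP; split; first by move=> _ [[A PA] _ <-].
  by move=> A PA; exists (exist _ A PA).
split; eexists; first exact: supremums_oideal_sigma.
exact: infimums_oideal_bigcap.
Qed.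

End Completeness.

Theorem theorem3p6 (d : Order.disp_t) (L : latticeType d)
    (distrL : infinitely_distributive L) :
  [/\ complete_lattice (oideal L),
      forall (I : Type) (A : I -> oideal L),
        supremums (range A) (oideal_sigma (\bigcup_i (A i : set L))),
      forall (I : Type) (A : I -> oideal L),
        infimums (range A) (oideal_bigcap A)
    & JID (oideal L)].
Proof.
have [jidL _] := distrL.
split.
- exact: complete_oideal.
- exact: supremums_oideal_sigma.
- exact: infimums_oideal_bigcap.
- exact: residuated_JID (oideal_residualP jidL).
Qed.
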